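(* There exists a real symmetric tensor of order six whose real rank and real symmetric rank differ.
   Context: All tensors are real. A tensor is decomposable if it equals $v_1\otimes\cdots\otimes v_d$; its rank is the minimal number of decomposable tensors summing to it. A symmetric tensor in $(\mathbb{R}^I)^{\otimes d}$ is one invariant under permuting indices; its symmetric rank is the minimal $r$ such that it equals $\sum_{i=1}^r\lambda_i v_i^{\otimes d}$ with $\lambda_i\in\mathbb{R}$, $v_i\in\mathbb{R}^I$. *)

(* Defs.v *)
From HB Require Import structures.
From mathcomp Require Import all_boot all_order all_algebra all_fingroup.
From mathcomp Require Import reals.
Set Implicit Arguments. Unset Strict Implicit. Unset Printing Implicit Defensive.
Import GRing.Theory Num.Theory.
Local Open Scope ring_scope.

Definition tensor (R : realType) (n d : nat) := {ffun 'I_d -> 'I_n} -> R.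

Definition sym_tensor (R : realType) (n d : nat) (T : tensor R n d) : Prop :=
  forall (s : 'S_d) (i : {ffun 'I_d -> 'I_n}), T [ffun j => i (s j)] = T i.

Definition rank_le (R : realType) (n d : nat) (T : tensor R n d) (r : nat) : Prop :=
  exists v : 'I_r -> 'I_d -> 'I_n -> R,
    forall i : {ffun 'I_d -> 'I_n},
      T i = \sum_(k < r) \prod_(j < d) v k j (i j).

Definition symrank_le (R : realType) (n d : nat) (T : tensor R n d) (r : nat) : Prop :=
  exists (lam : 'I_r -> R) (v : 'I_r -> 'I_n -> R),
    forall i : {ffun 'I_d -> 'I_n},
      T i = \sum_(k < r) lam k * \prod_(j < d) v k (i j).

Definition is_rank (R : realType) (n d : nat) (T : tensor R n d) (r : nat) : Prop :=
  rank_le T r /\ forall r', rank_le T r' -> (r <= r')%N.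

Definition is_symrank (R : realType) (n d : nat) (T : tensor R n d) (r : nat) : Prop :=
  symrank_le T r /\ forall r', symrank_le T r' -> (r <= r')%N.

(* Main.v *)
Require Import Defs.
From HB Require Import structures.
From mathcomp Require Import all_boot all_order all_algebra all_fingroup.
From mathcomp Require Import boolp reals.
From mathcomp Require Import zify ring lra.
Set Implicit Arguments. Unset Strict Implicit. Unset Printing Implicit Defensive.
Import Order.TTheory GRing.Theory Num.Theory.
Local Open Scope ring_scope.

(** Let V have a basis of two blocks of seven vectors, let a be the sum of the
basis, and let b be the sum of the first block minus the sum of the second. Let
W be a space of symmetric tensors of order five that contains all those supported
on index tuples meeting both blocks, and that has a basis of powers l_q^5 (q < k)
where the product of the coordinates of l_q at five distinct places of one block
is always 0. Adding new basis vectors y_q, take the polarization F of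
a^5 b + sum_q y_q l_q^5. Shifting y_q by vectors of V, independently in the six
modes, makes W (x) V in each mode available for free, at the price of 6 k
decomposable tensors in all; modulo that, the polarization of a^5 b is a multiple
of the single decomposable tensor a (x) ... (x) a (x) b, so the rank of F is at
most 6 k + 1.

Suppose F had a symmetric decomposition with 6 k + 1 terms
lam_m (x_m + y_m)^6. In each of the first five modes, substituting vectors of V
for the y_q kills k terms. The k + 1 surviving terms A_m (x) (x_m + y_m), with
A_m of order five, satisfy sum_m lam_m y_m (x) A_m = sum_q y_q (x) l_q^5, so the
A_m span W plus at most one dimension. Entries of F at six distinct places of
one block are +1 or -1 (up to scaling), which forces every A_m outside W to be
constant on blocks; two of them would give a nonzero element of W of the form
al p - be q with p, q decomposable and binary, which is impossible because fifth
roots are unique over the reals. So exactly one A_m is outside W, whence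
y_m = 0 for that m, and lam s^6 = 1, lam t^6 = -1 for the values s, t of x_m on
the two blocks: a contradiction over the reals. *)

(** * Symmetric tensors as combinations of powers *)

(** Inclusion-exclusion: a self-map [f] of ['I_d] is a bijection exactly when the product over [p]
    of 1 minus the indicator of [p] being missed by [f] is 1. Expanding this product, the set [A]
    contributes a sign times the indicator that [f] takes its values in [A]. *)
Lemma permanent_ryser (R : comNzRingType) d (z : 'I_d -> 'I_d -> R) :
  \sum_(s : 'S_d) \prod_j z (s j) j =
  \sum_(A : {set 'I_d}) (-1) ^+ #|~: A| * \prod_j \sum_(p in A) z p j.
Proof.
pose F := {ffun 'I_d -> 'I_d}.
transitivity (\sum_(f : F) (injectiveb f)%:R * \prod_j z (f j) j).
  rewrite [RHS](bigID (fun f : F => injectiveb f)) /= addrC [X in X + _]big1 ?add0r; last first.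
    by move=> f /negPf ->; rewrite mul0r.
  rewrite [RHS](reindex (@pval _)) /=; last first.
    pose in_Sn := insubd (1%g : 'S_d).
    by exists in_Sn => /= f Uf; first apply: val_inj; apply: insubdK.
  apply: eq_big => /= [s | s _]; rewrite ?(valP s) // mul1r.
  by apply: eq_bigr => j _; rewrite pvalE.
transitivity (\sum_(f : F) \sum_(A : {set 'I_d})
   ((-1) ^+ #|~: A| * \prod_j (f j \in A)%:R) * \prod_j z (f j) j).
  apply: eq_bigr => f _; rewrite -mulr_suml; congr (_ * _).
  transitivity (\prod_(p : 'I_d) (1 + - (p \notin codom f)%:R : R)).
    case: (boolP (injectiveb f)) => [/injectiveP inj_f|ninj].
      rewrite big1 // => p _; suff -> : p \in codom f by rewrite subr0.
      by apply: inj_card_onto => //; rewrite card_ord.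
    suff [p pN] : exists p, p \notin codom f.
      by rewrite (bigD1 p) //= pN subrr mul0r.
    apply/existsP; apply: contraNT ninj; rewrite negb_exists => /forallP h.
    apply/card_uniqP; rewrite size_map -cardE; apply: eq_card => p.
    by have := h p; rewrite negbK => ->; rewrite inE.
  rewrite bigA_distr; apply: eq_bigr => A _.
  rewrite [LHS](bigID (mem A)) /= big1 ?mul1r; last by move=> p ->.
  rewrite -prodr_const.
  case: (boolP [forall j, f j \in A]) => [/forallP fA | /forallPn [j jA]].
    rewrite [X in _ * X]big1 ?mulr1; last by move=> j _; rewrite fA.
    apply: eq_big => [p|p pA]; first by rewrite inE.
    rewrite (negPf pA); case: (boolP (_ \in _)) => [/codomP[j E]|]//.
    by rewrite E fA in pA.
  rewrite [X in _ * X](bigD1 j) //= (negPf jA) mul0r mulr0.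
  by rewrite (bigD1 (f j)) //= (negPf jA) codom_f oppr0 mul0r.
rewrite exchange_big; apply: eq_bigr => A _.
rewrite -(eq_bigr _ (fun f _ => mulrA _ _ _)) -mulr_sumr; congr (_ * _).
under [RHS]eq_bigr => j _ do rewrite big_mkcond.
rewrite bigA_distr_bigA /=; apply: eq_bigr => f _; rewrite -big_split /=.
by apply: eq_bigr => j _; case: ifP; rewrite ?mul1r ?mul0r.
Qed.

(** By symmetry [S] is the average over permutations of its expansion in basis tensors, and each
    such average is a permanent. Ryser's formula makes it a signed sum of d-th powers of the vectors
    [\sum_(p in A) e_(m p)]. *)
Lemma polarization (R : numFieldType) (I : finType) d
    (S : {ffun 'I_d -> I} -> R) :
  (forall (s : 'S_d) (i : {ffun 'I_d -> I}), S [ffun j => i (s j)] = S i) ->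
  forall i, S i = \sum_(m : {ffun 'I_d -> I}) \sum_(A : {set 'I_d})
     (S m / (d`!)%:R * (-1) ^+ #|~: A|) *
     \prod_j \sum_(p in A) (i j == m p)%:R.
Proof.
move=> symS i.
transitivity (\sum_(m : {ffun 'I_d -> I}) S m / (d`!)%:R *
  \sum_(s : 'S_d) \prod_j (i j == m (s j))%:R); last first.
  apply: eq_bigr => m _.
  rewrite (permanent_ryser (fun p j => (i j == m p)%:R)) mulr_sumr.
  by apply: eq_bigr => A _; rewrite mulrA.
under eq_bigr => m _ do rewrite mulr_sumr.
rewrite exchange_big /=.
transitivity (\sum_(s : 'S_d) S i / (d`!)%:R).
  rewrite sumr_const card_Sn -[_ *+ _]mulr_natr divfK //.
  by rewrite pnatr_eq0 -lt0n fact_gt0.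
apply: eq_bigr => s _.
rewrite (bigD1 [ffun j => i (s^-1%g j)]) //= [X in _ + X]big1 => [|m neq].
  rewrite big1 => [|j _]; last by rewrite ffunE permK eqxx.
  by rewrite addr0 mulr1 symS.
suff [j jP] : exists j, i j != m (s j) by rewrite (bigD1 j) //= (negPf jP) mul0r mulr0.
apply/existsP; apply: contraNT neq; rewrite negb_exists => /forallP h.
apply/eqP/ffunP => j; rewrite ffunE; have := h (s^-1%g j).
by rewrite negbK permKV => /eqP.
Qed.

(** * Linear algebra over a field *)

Lemma free_spanning_subfamily (R : fieldType) (J X : finType) (w : J -> X -> R) :
  exists k (e : 'I_k -> J),
    (forall c : 'I_k -> R,
       (forall x, \sum_q c q * w (e q) x = 0) -> forall q, c q = 0) /\
    (forall u : J -> R, exists c : 'I_k -> R,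
       forall x, \sum_j u j * w j x = \sum_q c q * w (e q) x).
Proof.
pose M : 'M[R]_(#|J|, #|X|) := \matrix_(a, b) w (enum_val a) (enum_val b).
pose e q := enum_val (maxrankfun M q).
exists (\rank M), e; split.
  move=> c cP q.
  suff: \row_q c q = 0 :> 'rV[R]_(\rank M) by move/rowP/(_ q); rewrite !mxE.
  apply: (row_free_inj (maxrowsub_free M)); rewrite mul0mx.
  apply/rowP => b; rewrite !mxE -[RHS](cP (enum_val b)).
  by apply: eq_bigr => a _; rewrite !mxE.
move=> u.
have : ((\row_a u (enum_val a)) *m M <= rowsub (maxrankfun M) M)%MS.
  by rewrite eq_maxrowsub submxMl.
case/submxP => D hD; exists (fun q => D 0 q) => x.
have := congr1 (fun N : 'rV_ _ => N 0 (enum_rank x)) hD; rewrite !mxE.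
under eq_bigr => a _ do rewrite !mxE enum_rankK.
rewrite -(big_enum_val (A := predT) (fun j => u j * w j x)) /= => ->.
by apply: eq_bigr => q _; rewrite !mxE enum_rankK.
Qed.

(** The kernel of [G] is a line, and the rows that annihilate it form a space of dimension k
    containing the row space of [G], hence equal to it. So [mu] tests membership in the row
    space. *)
Lemma row_free_kernel_vector (R : fieldType) k (G : 'M[R]_(k, k.+1)) :
  row_free G -> exists mu : 'cV[R]_k.+1,
    [/\ mu != 0, G *m mu = 0 &
        forall r : 'rV[R]_k.+1, r *m mu = 0 -> exists c, r = c *m G].
Proof.
move=> /eqP rkG.
have kerN0 : kermx G^T != 0.
  by rewrite -mxrank_eq0 mxrank_ker mxrank_tr rkG subSnn.
case/rowV0Pn: kerN0 => v /sub_kermxP vG vN0.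
have Gv : G *m v^T = 0 by apply: trmx_inj; rewrite trmx_mul trmxK vG trmx0.
exists v^T; split=> //; first by rewrite trmx_eq0.
move=> r rv.
have sub : (G <= kermx v^T)%MS by apply/sub_kermxP.
have : (kermx v^T <= G)%MS.
  rewrite -(geq_leqif (mxrank_leqif_sup sub)) mxrank_ker rkG.
  by rewrite mxrank_tr rank_rV vN0 subn1.
move=> h; apply/submxP; apply: submx_trans h; exact/sub_kermxP.
Qed.

(** * Rigidity of product tensors *)

(** There is one more value than there are factors, so a single argument can move from [u] to [u']
    with injectivity kept; as [c] is nonzero, the other factors cancel. *)
Lemma constant_of_injective_products (R : fieldType) n
    (p : 'I_n.+1 -> 'I_n.+2 -> R) (c : R) :
  c != 0 ->
  (forall i : 'I_n.+1 -> 'I_n.+2, injective i -> \prod_j p j (i j) = c) ->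
  forall j u u', p j u = p j u'.
Proof.
move=> c0 pc j u u'; have [->//|neq] := eqVneq u u'.
have [a ua] : exists a, u = lift u' a.
  by case: (unliftP u' u) => [a ->|E]; [exists a | rewrite E eqxx in neq].
(* [i] takes the value [u] at [j] and misses [u']; [i'] differs from it only at [j], where it takes
   the value [u']. *)
pose i j' := lift u' (tperm j a j').
pose i' j' := if j' == j then u' else i j'.
have inj_i : injective i by move=> x y /lift_inj /perm_inj.
have inj_i' : injective i'.
  move=> x y; rewrite /i'; case: eqP => [->|_]; case: eqP => [->|_] //.
  - by move/eqP; rewrite (negPf (neq_lift _ _)).
  - by move/eqP; rewrite eq_sym (negPf (neq_lift _ _)).
  - exact: inj_i.
have := pc _ inj_i; rewrite (bigD1 j) //= {1}/i tpermL -ua => E.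
have := pc _ inj_i'; rewrite (bigD1 j) //= {1}/i' eqxx => E'.
have {}E' : p j u' * \prod_(k | k != j) p k (i k) = c.
  by rewrite -E'; congr (_ * _); apply: eq_bigr => k /negPf kj; rewrite /i' kj.
apply: (@mulIf _ (\prod_(k | k != j) p k (i k))); last by rewrite E E'.
by apply: contraNneq c0 => z; rewrite -E z mulr0.
Qed.

Lemma exprn_odd_inj (R : realDomainType) n : odd n -> injective (fun x : R => x ^+ n).
Proof.
move=> on x y /= E; have n0 : (0 < n)%N by case: n on {E}.
case: (lerP 0 x) => x0.
  have y0 : 0 <= y by rewrite -(exprn_odd_ge0 y on) -E exprn_ge0.
  by apply/eqP; rewrite -(eqrXn2 n0 x0 y0) E.
have y0 : y < 0 by rewrite -(exprn_odd_lt0 y on) -E exprn_odd_lt0.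
apply/eqP; rewrite -eqr_opp -(eqrXn2 n0) ?oppr_ge0 ?ltW //.
by rewrite [(- x) ^+ n]exprNn [(- y) ^+ n]exprNn E.
Qed.

Lemma sym_binary_rank_two (R : realFieldType) n (p q : 'I_n -> bool -> R) (al be : R) :
  odd n -> (2 < n)%N -> al != 0 -> (forall j b, p j b != 0) -> (forall j b, q j b != 0) ->
  let w B := al * \prod_j p j (B j) - be * \prod_j q j (B j) in
  (forall (s : 'S_n) B, w (fun j => B (s j)) = w B) ->
  w (fun=> true) = 0 -> w (fun=> false) = 0 -> forall B, w B = 0.
Proof.
move=> on n2 al0 p0 q0 w symw wT wF.
(* After scaling, the entries are the differences of products of the ratios [r p]
and [r q]; symmetry in one and in two places makes [r p - r q] constant and, if
nonzero, [r p] and [r q] constant with equal n-th powers. *)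
pose r (f : 'I_n -> bool -> R) j := f j false / f j true.
have prodE f (B : 'I_n -> bool) : (forall j b, f j b != 0) ->
    \prod_j f j (B j) = \prod_j f j true * \prod_j (if B j then 1 else r f j).
  move=> f0; rewrite -big_split /=; apply: eq_bigr => j _.
  by case: (B j); rewrite ?mulr1 // /r mulrCA divff ?mulr1.
pose C := al * \prod_j p j true.
have C0 : C != 0 by rewrite mulf_neq0 // prodf_seq_neq0; apply/allP=> j _; rewrite p0.
have CE : be * \prod_j q j true = C by apply/esym/eqP; rewrite -subr_eq0; apply/eqP.
pose v (B : 'I_n -> bool) :=
  \prod_j (if B j then 1 else r p j) - \prod_j (if B j then 1 else r q j).
have wE B : w B = C * v B.
  by rewrite /w (prodE p) // (prodE q) // !mulrA CE -mulrBr.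
have symv (s : 'S_n) B : v (fun j => B (s j)) = v B.
  by apply: (mulfI C0); rewrite -!wE symw.
have eqv B B' : B =1 B' -> v B = v B'.
  by move=> E; congr (_ - _); apply: eq_bigr => j _; rewrite E.
have r0 : r p =1 r q -> forall B, w B = 0.
  move=> E B; rewrite wE [v B](_ : _ = 0) ?mulr0 //.
  apply/eqP; rewrite subr_eq0; apply/eqP/eq_bigr => j _.
  by rewrite E.
(* These patterns are false at one place and at two places; they isolate one ratio and a product of
   two ratios. *)
pose B1 (j i : 'I_n) := i != j.
pose B2 (j k i : 'I_n) := (i != j) && (i != k).
have one (f : 'I_n -> R) j : \prod_i (if B1 j i then 1 else f i) = f j.
  rewrite (bigD1 j) //= /B1 eqxx /= big1 ?mulr1 // => i ij.
  by rewrite ij.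
have two (f : 'I_n -> R) j k : j != k -> \prod_i (if B2 j k i then 1 else f i) = f j * f k.
  move=> jk; rewrite (bigD1 j) //= (bigD1 k) 1?eq_sym //= /B2 !eqxx /= andbF.
  rewrite big1 ?mulr1 // => i /andP[ij ik].
  by rewrite ij ik.
have tpneq (j k i l : 'I_n) : (tperm j k i != l) = (i != tperm j k l).
  by rewrite -{1}(tpermK j k l) (inj_eq perm_inj).
have sym1 j k : r p j - r q j = r p k - r q k.
  have := symv (tperm j k) (B1 k); rewrite (eqv _ (B1 j)).
    by rewrite /v !one.
  by move=> i; rewrite /B1 tpneq tpermR.
have sym2 j k l : l != j -> l != k ->
    r p j * r p l - r q j * r q l = r p k * r p l - r q k * r q l.
  move=> lj lk; have := symv (tperm j k) (B2 k l); rewrite (eqv _ (B2 j l)).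
    by rewrite /v !two // eq_sym.
  by move=> i; rewrite /B2 !tpneq tpermR tpermD // eq_sym.
have third (j k : 'I_n) : exists l, (l != j) && (l != k).
  apply/existsP; apply: contraTT n2; rewrite negb_exists => /forallP h.
  rewrite -leqNgt -[n]card_ord -cardsT.
  apply: (@leq_trans #|[set j; k]|); last by rewrite cards2; case: (_ != _).
  apply: subset_leq_card; apply/subsetP => l _; have := h l.
  by rewrite negb_and !negbK !inE.
have n0 : (0 < n)%N := ltnW (ltnW n2).
pose j0 := Ordinal n0.
pose de := r p j0 - r q j0.
have pq j : r p j = r q j + de by rewrite /de (sym1 j0 j) addrC subrK.
have [d0|dn0] := eqVneq de 0; first by apply: r0 => j; rewrite pq d0 addr0.
have qc j : r q j = r q j0.
  have [l /andP[lj l0]] := third j j0.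
  apply: (mulfI dn0); have := sym2 _ _ _ lj l0; rewrite !pq => h.
  by lra.
apply: r0 => j.
have := wF; rewrite wE => /eqP; rewrite mulf_eq0 (negPf C0) /= subr_eq0 => /eqP.
under eq_bigr => i _ do rewrite /= pq qc.
under [RHS]eq_bigr => i _ do rewrite /= qc.
rewrite !prodr_const card_ord => /(exprn_odd_inj on) h.
by rewrite pq qc.
Qed.

(** * Polarized forms and their contraction with product functionals *)

(* The polarization of the form [d * u * w ^ d.-1]. *)
Definition dtens (R : pzSemiRingType) (K : Type) d (u w : K -> R) (i : 'I_d -> K) : R :=
  \sum_j u (i j) * \prod_(j' | j' != j) w (i j').

Lemma dtens_perm (R : comPzSemiRingType) (K : Type) d (u w : K -> R) (i : 'I_d -> K)
  (s : 'S_d) : dtens u w (fun j => i (s j)) = dtens u w i.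
Proof.
rewrite /dtens [RHS](reindex_inj (@perm_inj _ s)) /=; apply: eq_bigr => j _.
rewrite [in RHS](reindex_inj (@perm_inj _ s)) /=; congr (_ * _).
by apply: eq_bigl => j'; rewrite (inj_eq perm_inj).
Qed.

Definition pairing (R : pzSemiRingType) (K : finType) (z v : K -> R) : R :=
  \sum_x z x * v x.

Lemma pairing_prod (R : comPzSemiRingType) (K : finType) d (z v : 'I_d -> K -> R) :
  \sum_(i : {ffun 'I_d -> K}) (\prod_j z j (i j)) * (\prod_j v j (i j)) =
  \prod_j pairing (z j) (v j).
Proof.
rewrite bigA_distr_bigA; apply: eq_bigr => i _; by rewrite -big_split.
Qed.

Lemma pairing_dtens (R : comPzSemiRingType) (K : finType) d (z : 'I_d -> K -> R)
    (u w : K -> R) :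
  \sum_(i : {ffun 'I_d -> K}) (\prod_j z j (i j)) * dtens u w i =
  \sum_j pairing (z j) u * \prod_(j' | j' != j) pairing (z j') w.
Proof.
under eq_bigr => i _ do rewrite mulr_sumr.
rewrite exchange_big; apply: eq_bigr => j _ /=.
pose v j' x := if j' == j then u x else w x.
transitivity (\prod_j' pairing (z j') (v j')).
  rewrite -pairing_prod; apply: eq_bigr => i _; congr (_ * _).
  rewrite [RHS](bigD1 j) //= {1}/v eqxx; congr (_ * _).
  by apply: eq_bigr => j' /negPf jj'; rewrite /v jj'.
rewrite (bigD1 j) //=; congr (_ * _).
  by apply: eq_bigr => x _; rewrite /v eqxx.
apply: eq_bigr => j' /negPf jj'.
by apply: eq_bigr => x _; rewrite /v jj'.
Qed.

Lemma prod_lift (R : comPzSemiRingType) n (j : 'I_n.+1) (f : 'I_n.+1 -> R) :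
  \prod_(j' | j' != j) f j' = \prod_(a < n) f (lift j a).
Proof.
rewrite (reindex_omap (lift j) (unlift j)); last first.
  by move=> j' jj'; case: unliftP => [a ->|E] //; rewrite E eqxx in jj'.
by apply: eq_bigl => a; rewrite liftK eqxx eq_sym neq_lift.
Qed.

(** * The two blocks and the space of tensors supported on mixed tuples *)

(** The Boolean names the block. Seven places per block are one more than the six modes, as
    [constant_of_injective_products] requires. *)
Definition point := (bool * 'I_7)%type.

Definition mixed (m : {ffun 'I_5 -> point}) : bool :=
  [exists j, (m j).1] && [exists j, ~~ (m j).1].

Definition sgnb (R : pzRingType) (x : point) : R := if x.1 then 1 else -1.

Lemma mixed_perm (m : {ffun 'I_5 -> point}) (s : 'S_5) :
  mixed [ffun j => m (s j)] = mixed m.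
Proof.
congr (_ && _); apply/existsP/existsP => -[j mj].
- by exists (s j); rewrite ffunE in mj.
- by exists (s^-1%g j); rewrite ffunE permKV.
- by exists (s j); rewrite ffunE in mj.
- by exists (s^-1%g j); rewrite ffunE permKV.
Qed.

(** A mixed tuple has an entry outside block [b], so at most four of its values lie in [b]. *)
Lemma mixed_codom_missing (m : {ffun 'I_5 -> point}) (y : 'I_5 -> point) b :
  mixed m -> injective y -> (forall j, (y j).1 = b) -> exists j, y j \notin codom m.
Proof.
move=> /andP[/existsP[j1 mj1] /existsP[j2 mj2]] inj_y yb.
apply/existsP; apply: contraT; rewrite negb_exists => /forallP h.
have sub : codom y \subset codom m.
  by apply/subsetP => x /codomP[j ->]; have := h j; rewrite negbK.
have cy : #|codom y| = 5 by rewrite card_codom // card_ord.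
have cm : (#|codom m| <= 5)%N.
  by rewrite -[X in (_ <= X)%N](card_ord 5) leq_image_card.
have eqc : codom y =i codom m by apply/subset_cardP => //; apply/eqP; rewrite eqn_leq subset_leq_card //= cy.
have : m j1 \in codom y by rewrite eqc codom_f.
have : m j2 \in codom y by rewrite eqc codom_f.
move=> /codomP[a ea] /codomP[a' ea']; move: mj1 mj2.
by rewrite ea ea' !yb => ->.
Qed.

Definition independent_powers (R : pzRingType) k (l : 'I_k -> point -> R) :=
  forall c : 'I_k -> R,
    (forall x : {ffun 'I_5 -> point}, \sum_q c q * \prod_j l q (x j) = 0) ->
    forall q, c q = 0.

Definition vanishing_on_blocks (R : comPzRingType) k (l : 'I_k -> point -> R) :=
  forall q (y : 'I_5 -> point) b, injective y -> (forall j, (y j).1 = b) ->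
    \prod_j l q (y j) = 0.

Definition spanning_mixed (R : pzRingType) k (l : 'I_k -> point -> R) :=
  forall S : {ffun 'I_5 -> point} -> R,
    (forall (s : 'S_5) (i : {ffun 'I_5 -> point}), S [ffun j => i (s j)] = S i) ->
    (forall m, ~~ mixed m -> S m = 0) ->
    exists c : 'I_k -> R, forall x, S x = \sum_q c q * \prod_j l q (x j).

(** The powers come from polarizing mixed basis tensors. Each vector used is supported on the values
    of one mixed tuple, so it vanishes at one of any five distinct places of a block; a free
    subfamily with the same span is then extracted. *)
Lemma mixed_power_basis (R : numFieldType) :
  exists k (l : 'I_k -> point -> R),
  [/\ independent_powers l, vanishing_on_blocks l & spanning_mixed l].
Proof.
pose T := ({ffun 'I_5 -> point} * {set 'I_5})%type.
(* The value 0 for tuples that are not mixed lets the family be indexed by all tuples; their powers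
   are zero. *)
pose ell (t : T) (x : point) : R :=
  if mixed t.1 then \sum_(p in t.2) (x == t.1 p)%:R else 0.
pose w (t : T) (x : {ffun 'I_5 -> point}) := \prod_j ell t (x j).
have [k [e [free span]]] := free_spanning_subfamily w.
exists k, (fun q => ell (e q)); split=> [c|q y b inj_y yb|S symS S0].
- exact: free.
- rewrite /ell; case: (boolP (mixed (e q).1)) => [mx|_]; last by rewrite big_ord_recl mul0r.
  have [j jN] := mixed_codom_missing mx inj_y yb.
  rewrite (bigD1 j) //= big1 ?mul0r // => p _.
  by case: eqP => // E; rewrite E codom_f in jN.
pose u (t : T) := S t.1 / (5`!)%:R * (-1) ^+ #|~: t.2|.
have [c hc] := span u; exists c => x; rewrite -[RHS](hc x).
rewrite (polarization symS) pair_big /=; apply: eq_bigr => -[m A] _ /=.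
rewrite /u /w /ell /=; case: (boolP (mixed m)) => // /S0 ->.
by rewrite !mul0r.
Qed.

(** * The tensor and the upper bound on its rank *)

Definition ext0 (R : nmodType) (k : nat) (u : point -> R) (x : point + 'I_k) : R :=
  if x is inl y then u y else 0.

Definition delta_new (R : pzSemiRingType) (k : nat) (q : 'I_k) (x : point + 'I_k) : R :=
  if x is inr q' then (q' == q)%:R else 0.

(** This is 6 times the polarization F, which avoids denominators: the entries at tuples inside one
    block are 6 or -6. *)
Definition comon_tensor (R : pzRingType) k (l : 'I_k -> point -> R)
    (i : 'I_6 -> point + 'I_k) : R :=
  dtens (ext0 (@sgnb R)) (ext0 (fun=> 1)) i + \sum_q dtens (delta_new R q) (ext0 (l q)) i.

Lemma comon_tensor_perm (R : comPzRingType) k (l : 'I_k -> point -> R) i (s : 'S_6) :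
  comon_tensor l (fun j => i (s j)) = comon_tensor l i.
Proof.
by rewrite /comon_tensor dtens_perm; congr (_ + _); apply: eq_bigr => q _; rewrite dtens_perm.
Qed.

(* [dtens b a - 6 a (x) a (x) a (x) a (x) a (x) b] is the sum over the modes j of
[weight j] times the product with b in mode j and a elsewhere. *)
Definition weight (R : pzRingType) (j : 'I_6) : R := if j == ord_max then -5 else 1.

Lemma sum_weight (R : pzRingType) : \sum_j weight R j = 0.
Proof.
rewrite big_ord_recr /= (eq_bigr (fun=> 1)) => [|j _].
  by rewrite sumr_const card_ord /weight eqxx subrr.
by rewrite /weight ifN //; apply/eqP => /(congr1 val) /= E; have := ltn_ord j; rewrite E.
Qed.

Lemma sum_weight_mul (R : comPzRingType) (f : 'I_6 -> R) :
  \sum_j f j = 6 * f ord_max + \sum_j weight R j * f j.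
Proof.
rewrite [LHS]big_ord_recr [in RHS]big_ord_recr /= [weight R ord_max]/weight eqxx.
have -> : \sum_(i < 5) weight R (widen_ord (leqnSn 5) i) * f (widen_ord (leqnSn 5) i)
   = \sum_(i < 5) f (widen_ord (leqnSn 5) i).
  apply: eq_bigr => i _; rewrite /weight ifN ?mul1r //.
  by apply/eqP => /(congr1 val) /= E; have := ltn_ord i; rewrite E.
ring.
Qed.

Definition nfalse d (y : 'I_d -> point) : nat := \sum_j ~~ (y j).1.

(* Since the weights sum to 0, [sgnb (i j)] may be shifted by any function of the
number of entries in the second block; this shift makes it vanish whenever the
other five entries lie in one block. *)
Definition eps (R : pzRingType) (c : nat) : R := if c \in [:: 0; 5]%N then -1 else 1.

Lemma sgnb_eps_pure (R : pzRingType) (u : point) (m : {ffun 'I_5 -> point}) :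
  ~~ mixed m -> sgnb R u + eps R (~~ u.1 + nfalse m) = 0.
Proof.
have nf b : (forall j, (m j).1 = b) -> nfalse m = (if b then 0 else 5)%N.
  move=> mb; rewrite /nfalse; under eq_bigr => j _ do rewrite mb.
  by rewrite sum_nat_const card_ord; case: b {mb}.
rewrite negb_and => /orP[] /existsPn h.
  have -> : nfalse m = 5 by rewrite (nf false) // => j; apply: negbTE.
  by case: u => -[] a; rewrite /sgnb /eps /= ?addNr ?addrN.
have -> : nfalse m = 0 by rewrite (nf true) // => j; have := h j; rewrite negbK.
by case: u => -[] a; rewrite /sgnb /eps /= ?addNr ?addrN.
Qed.

(** [None] stands for the product with a in five modes and 6 b in the last. [Some (q, j0)] has [l q]
    outside mode [j0], and in mode [j0] the new vector [q] plus a correction in V; the corrections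
    must sum to the weighted terms. *)
Lemma comon_tensor_rank (R : realFieldType) k (l : 'I_k -> point -> R) :
  spanning_mixed l ->
  exists v : option ('I_k * 'I_6) -> 'I_6 -> point + 'I_k -> R,
    forall i, comon_tensor l i = \sum_t \prod_j v t j (i j).
Proof.
move=> span.
(* Cutting off outside the mixed tuples loses nothing, since the shifted sign is 0 there by
   [sgnb_eps_pure]; it brings [S u] into the span of the powers. *)
pose S u (m : {ffun 'I_5 -> point}) : R :=
  if mixed m then sgnb R u + eps R (~~ u.1 + nfalse m) else 0.
have : forall u, exists c : {ffun 'I_k -> R}, forall x,
    S u x = \sum_q c q * \prod_j l q (x j).
  move=> u; have [|m /negPf mN|c cP] := span (S u).
  - move=> s i; rewrite /S mixed_perm; case: ifP => // _; congr (_ + eps _ (_ + _)).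
    rewrite /nfalse [RHS](reindex_inj (@perm_inj _ s)) /=.
    by apply: eq_bigr => j _; rewrite ffunE.
  - by rewrite /S mN.
  by exists (finfun c) => x; rewrite cP; apply: eq_bigr => q _; rewrite ffunE.
case/fin_all_exists => h hP.
pose v (t : option ('I_k * 'I_6)) (j : 'I_6) (x : point + 'I_k) : R :=
  if t is Some (q, j0) then
    if j == j0 then delta_new R q x + weight R j0 * ext0 (fun u => h u q) x
    else ext0 (l q) x
  else (if j == ord_max then 6 * ext0 (@sgnb R) x else ext0 (fun=> 1) x).
exists v => i.
rewrite (bigD1 None) //=.
have -> : \sum_(t | t != None) \prod_j v t j (i j) =
   \sum_q dtens (delta_new R q) (ext0 (l q)) i +
   \sum_q \sum_j weight R j * ext0 (fun u => h u q) (i j) *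
      \prod_(j' | j' != j) ext0 (l q) (i j').
  rewrite -big_split /=; under [RHS]eq_bigr => q _ do rewrite -big_split /=.
  rewrite pair_big /= (reindex_omap (@Some _) id) /=; last by case.
  apply: eq_big => [t|[q j0] _]; first by rewrite eqxx.
  rewrite -mulrDl (bigD1 j0) //= eqxx; congr (_ * _).
  by apply: eq_bigr => j /negPf ->.
rewrite addrCA addrC /comon_tensor; congr (_ + _).
rewrite /dtens.
(* If some index is new, every remaining term vanishes, having in that mode a vector of V. *)
case: (boolP [forall j, if i j is inl _ then true else false]) => [/forallP inI|]; last first.
  case/forallPn => j; case E : (i j) => [//|q'] _.
  have ext0E u : ext0 u (i j) = 0 :> R by rewrite E.
  rewrite big1 => [|j0 _]; last first.
    have [->|jj0] := eqVneq j0 j; first by rewrite ext0E mul0r.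
    by rewrite (bigD1 j) 1?eq_sym //= ext0E mul0r mulr0.
  rewrite (bigD1 j) //= !ext0E mulr0 if_same mul0r add0r.
  rewrite big1 // => q _; rewrite big1 // => j0 _.
  have [->|jj0] := eqVneq j0 j; first by rewrite ext0E mulr0 mul0r.
  by rewrite (bigD1 j) 1?eq_sym //= ext0E mul0r mulr0.
have {}inI j : exists y, i j = inl y.
  by have := inI j; case: (i j) => // y _; exists y.
have [y yP] := fin_all_exists inI.
rewrite [LHS](eq_bigr (fun j => sgnb R (y j))) => [|j _]; last first.
  by rewrite yP big1 ?mulr1 // => j' _; rewrite yP.
rewrite [X in _ = X + _](bigD1 ord_max) //= yP [X in _ * X]big1 => [|j /negPf jm]; last by rewrite jm yP.
rewrite mulr1 sum_weight_mul; congr (_ + _).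
rewrite exchange_big /=.
(* The shift depends on all six entries together, so it is the same for every mode and cancels
   against [sum_weight]. *)
pose e := eps R (nfalse y).
transitivity (\sum_j weight R j * (sgnb R (y j) + e)).
  under [RHS]eq_bigr => j _ do rewrite mulrDr.
  by rewrite big_split /= -mulr_suml sum_weight mul0r addr0.
apply: eq_bigr => j _; pose m := [ffun a => y (lift j a)].
have nfE : (~~ (y j).1 + nfalse m)%N = nfalse y.
  rewrite /nfalse [RHS](bigD1_ord j) //=; congr (_ + _)%N.
  by apply: eq_bigr => a _; rewrite ffunE.
transitivity (weight R j * S (y j) m).
  congr (_ * _); rewrite /S nfE; case: ifPn => // /(sgnb_eps_pure R (y j)).
  by rewrite nfE.
rewrite hP mulr_sumr; apply: eq_bigr => q _; rewrite yP mulrA; congr (_ * _).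
by rewrite prod_lift; apply: eq_bigr => a _; rewrite ffunE yP.
Qed.

(** * Contracting a symmetric decomposition *)

Lemma row_free_of_inj (R : fieldType) m n (G : 'M[R]_(m, n)) :
  (forall r : 'rV_m, r *m G = 0 -> r = 0) -> row_free G.
Proof.
move=> inj; rewrite -kermx_eq0; apply/rowV0P => r /sub_kermxP; exact: inj.
Qed.

Lemma sum_set_ord (T : finType) (M : {set T}) n : #|M| = n ->
  exists e : 'I_n -> T, forall (R : nmodType) (F : T -> R),
    \sum_(m in M) F m = \sum_a F (e a).
Proof. by move=> <-; exists enum_val => R F; rewrite big_enum_val. Qed.

(* The [x]-coordinate of the projection that is the identity on the old
coordinates and sends the new basis vector [q] to [- L q]. *)
Definition shear (R : pzRingType) k (L : 'I_k -> point -> R) (x : point)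
    (y : point + 'I_k) : R :=
  match y with inl x' => (x' == x)%:R | inr q => - L q x end.

Definition on_new (R : nmodType) k (c : 'I_k -> R) (y : point + 'I_k) : R :=
  if y is inr q then c q else 0.

Lemma pairing_shear (R : pzRingType) k (L : 'I_k -> point -> R) x v :
  pairing (shear L x) v = v (inl x) - \sum_q L q x * v (inr q).
Proof.
rewrite /pairing big_sumType /= (bigD1 x) //= eqxx mul1r big1 ?addr0.
  by rewrite -sumrN; congr (_ + _); apply: eq_bigr => q _; rewrite mulNr.
by move=> x' /negPf ->; rewrite mul0r.
Qed.

Lemma pairing_shear_ext0 (R : pzRingType) k (L : 'I_k -> point -> R) x u :
  pairing (shear L x) (ext0 u) = u x.
Proof. by rewrite pairing_shear big1 ?subr0 // => q _; rewrite mulr0. Qed.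

Lemma pairing_on_new (R : pzRingType) k (c : 'I_k -> R) v :
  pairing (on_new c) v = \sum_q c q * v (inr q).
Proof.
by rewrite /pairing big_sumType /= big1 ?add0r // => x _; rewrite mul0r.
Qed.

Lemma pairing_on_new_ext0 (R : pzRingType) k (c : 'I_k -> R) u :
  pairing (on_new c) (ext0 u) = 0.
Proof. by rewrite pairing_on_new big1 // => q _; rewrite mulr0. Qed.

Lemma pairing_on_new_delta (R : pzRingType) k (c : 'I_k -> R) q :
  pairing (on_new c) (delta_new R q) = c q.
Proof.
rewrite pairing_on_new (bigD1 q) //= eqxx mulr1 big1 ?addr0 // => q' /negPf.
by rewrite /= => ->; rewrite mulr0.
Qed.

Definition symdec (R : pzRingType) k (l : 'I_k -> point -> R) N
    (lam : 'I_N -> R) (v : 'I_N -> point + 'I_k -> R) :=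
  forall i : 'I_6 -> point + 'I_k,
    comon_tensor l i = \sum_m lam m * \prod_j v m (i j).

Lemma symdec_contract (R : comPzRingType) k (l : 'I_k -> point -> R) N lam v
    (z : 'I_6 -> point + 'I_k -> R) :
  @symdec R k l N lam v ->
  \sum_m lam m * \prod_j pairing (z j) (v m) =
  \sum_j pairing (z j) (ext0 (@sgnb R)) * \prod_(j' | j' != j) pairing (z j') (ext0 (fun=> 1)) +
  \sum_q \sum_j pairing (z j) (delta_new R q) *
     \prod_(j' | j' != j) pairing (z j') (ext0 (l q)).
Proof.
move=> dec; under eq_bigr => m _ do rewrite -pairing_prod mulr_sumr.
rewrite exchange_big /=.
transitivity (\sum_(i : {ffun 'I_6 -> point + 'I_k}) (\prod_j z j (i j)) * comon_tensor l i).
  apply: eq_bigr => i _; rewrite dec mulr_sumr; apply: eq_bigr => m _.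
  by rewrite mulrCA.
rewrite [LHS](eq_bigr (fun i : {ffun 'I_6 -> point + 'I_k} =>
    (\prod_j z j (i j)) * dtens (ext0 (@sgnb R)) (ext0 (fun=> 1)) i +
    \sum_q (\prod_j z j (i j)) * dtens (delta_new R q) (ext0 (l q)) i)); last first.
  by move=> i _; rewrite /comon_tensor mulrDr; congr (_ + _); rewrite mulr_sumr.
rewrite big_split /= pairing_dtens exchange_big /=; congr (_ + _).
by apply: eq_bigr => q _; rewrite pairing_dtens.
Qed.

(** The functional in mode [t] kills V, so only the terms with a new vector in mode [t] survive.
    Their other factors lie in V, which every shear fixes; hence the right side does not depend on
    [L]. *)
Lemma symdec_contract_new (R : comPzRingType) k (l : 'I_k -> point -> R) N lam v
    (L : 'I_6 -> 'I_k -> point -> R) (c : 'I_k -> R) (t : 'I_6) (x : 'I_5 -> point) :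
  @symdec R k l N lam v ->
  \sum_m lam m * (\sum_q c q * v m (inr q)) *
     \prod_a pairing (shear (L (lift t a)) (x a)) (v m) =
  \sum_q c q * \prod_a l q (x a).
Proof.
move=> dec.
(* The value at [t] is a dummy, since [z t] is [on_new c]. *)
pose x6 (j : 'I_6) := if unlift t j is Some a then x a else x ord0.
pose z (j : 'I_6) := if j == t then on_new c else shear (L j) (x6 j).
have zt : z t = on_new c by rewrite /z eqxx.
have zl a : z (lift t a) = shear (L (lift t a)) (x a).
  by rewrite /z eq_sym (negPf (neq_lift _ _)) /x6 liftK.
have vanish j u : j != t -> \prod_(j' | j' != j) pairing (z j') (ext0 u) = 0.
  by move=> jt; rewrite (bigD1 t) 1?eq_sym //= zt pairing_on_new_ext0 mul0r.
transitivity (\sum_m lam m * \prod_j pairing (z j) (v m)).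
  apply: eq_bigr => m _; rewrite (bigD1 t) //= zt prod_lift pairing_on_new mulrA.
  by congr (_ * _); apply: eq_bigr => a _; rewrite zl.
rewrite (symdec_contract z dec) big1 ?add0r; last first.
  move=> j _; have [->|/vanish ->] := eqVneq j t; last by rewrite mulr0.
  by rewrite zt pairing_on_new_ext0 mul0r.
apply: eq_bigr => q _; rewrite (bigD1 t) //= [X in _ + X]big1 ?addr0; last first.
  by move=> j /vanish ->; rewrite mulr0.
rewrite zt pairing_on_new_delta prod_lift; congr (_ * _).
by apply: eq_bigr => a _; rewrite zl pairing_shear_ext0.
Qed.

(** A shear by 0 in the last mode reads off the old coordinate. Each term with a new vector carries
    a product of [l q] over five distinct places of one block, which is 0; the six summands of the
    polarized a^5 b remain. *)
Lemma symdec_contract_old (R : comPzRingType) k (l : 'I_k -> point -> R) N lam v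
    (L : 'I_6 -> 'I_k -> point -> R) (b : bool) (x : 'I_6 -> point) :
  vanishing_on_blocks l ->
  @symdec R k l N lam v -> injective x -> (forall j, (x j).1 = b) ->
  \sum_m lam m * v m (inl (x ord_max)) *
     \prod_a pairing (shear (L (lift ord_max a)) (x (lift ord_max a))) (v m) =
  if b then 6 else - 6.
Proof.
move=> pure dec inj_x xb.
pose L' (j : 'I_6) := if j == ord_max then fun _ _ => 0 else L j.
transitivity (\sum_m lam m * \prod_j pairing (shear (L' j) (x j)) (v m)).
  apply: eq_bigr => m _; rewrite [in RHS](bigD1 ord_max) //= pairing_shear [X in _ - X]big1 ?subr0; last first.
    by move=> q _; rewrite /L' eqxx mul0r.
  rewrite prod_lift mulrA; congr (_ * _); apply: eq_bigr => a _.
  by rewrite /L' eq_sym (negPf (neq_lift _ _)).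
rewrite (symdec_contract (fun j => shear (L' j) (x j)) dec) [X in _ + X]big1 ?addr0 => [|q _]; last first.
  rewrite big1 // => j _; under eq_bigr => j' _ do rewrite pairing_shear_ext0.
  by rewrite prod_lift (pure _ _ b) ?mulr0 // => a a' /inj_x /lift_inj.
rewrite (eq_bigr (fun=> if b then 1 else -1)) => [|j _].
  by rewrite sumr_const card_ord; case: b {xb}; rewrite // mulNrn.
rewrite pairing_shear_ext0 /sgnb xb big1 ?mulr1 // => j' _.
by rewrite pairing_shear_ext0.
Qed.

(** [M] holds the terms that survive the first [t] modes. Each further mode removes k of them,
    chosen so that their new coordinates form an invertible matrix. *)
Lemma symdec_kill (R : fieldType) k (l : 'I_k -> point -> R) N lam v :
  independent_powers l ->
  @symdec R k l N lam v ->
  forall t, (t <= 5)%N -> exists (L : 'I_6 -> 'I_k -> point -> R) (M : {set 'I_N}),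
    (#|M| + t * k = N)%N /\
    forall m, m \notin M -> exists2 j : 'I_6, (j < t)%N &
       forall x, pairing (shear (L j) x) (v m) = 0.
Proof.
move=> free dec; elim=> [_|t IH lt5].
  exists (fun _ _ _ => 0), setT; split=> [|m]; last by rewrite inE.
  by rewrite cardsT card_ord addn0.
have [L [M [cM killed]]] := IH (ltnW lt5).
have lt6 : (t < 6)%N by apply: ltnW.
pose jt := Ordinal lt6.
pose Y : 'M[R]_(#|M|, k) := \matrix_(a, q) v (enum_val a) (inr q).
(* A relation among the columns of [Y], contracted in mode [jt], would be a relation among the
   powers of the [l q]: the terms outside [M] already vanish in an earlier mode. *)
have fullY : row_full Y.
  rewrite /row_full -mxrank_tr; apply: row_free_of_inj => r rY.
  apply/rowP => q; rewrite [RHS]mxE; apply: (free (r 0)) => x.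
  rewrite -(symdec_contract_new L (r 0) jt x dec) big1 // => m _.
  have [mM|/killed [j jt_lt kj]] := boolP (m \in M).
    suff -> : \sum_q' r 0 q' * v m (inr q') = 0 by rewrite mulr0 mul0r.
    have := congr1 (fun A : 'rV_ _ => A 0 (enum_rank_in mM m)) rY.
    rewrite mxE [RHS]mxE => E; rewrite -[RHS]E; apply: eq_bigr => q' _.
    by rewrite !mxE enum_rankK_in.
  case: (unliftP jt j) => [a ja|jE]; last by rewrite jE ltnn in jt_lt.
  by rewrite (bigD1 a) //= -ja kj mul0r mulr0.
pose f := fullrankfun fullY; pose Yf := rowsub f Y.
have unitY : Yf \in unitmx := fullrowsub_unit fullY.
have inj_f : injective f by apply: fullrankfun_inj.
(* The solution of the linear system saying that the sheared vectors of the k chosen terms are 0. *)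
pose La q x := (invmx Yf *m \col_a v (enum_val (f a)) (inl x)) q 0.
pose B := [set enum_val (f q) | q : 'I_k].
exists (fun j => if j == jt then La else L j), (M :\: B); split.
  have cB : #|B| = k by rewrite card_imset ?card_ord // => q q' /enum_val_inj /inj_f.
  have sB : B \subset M by apply/subsetP => m /imsetP[q _ ->]; apply: enum_valP.
  by rewrite cardsD (setIidPr sB) cB mulSn addnA subnK // -cB subset_leq_card.
move=> m; rewrite inE negb_and negbK => /orP[/imsetP[a _ ->]|/killed [j ltj kj]].
  exists jt => // x; rewrite eqxx pairing_shear; apply/eqP; rewrite subr_eq0; apply/eqP.
  have : Yf *m (invmx Yf *m \col_a v (enum_val (f a)) (inl x)) =
      \col_a v (enum_val (f a)) (inl x) by rewrite mulKVmx.
  move/(congr1 (fun A : 'cV_ _ => A a 0)); rewrite mxE [RHS]mxE => <-.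
  by apply: eq_bigr => q _; rewrite /La !mxE mulrC.
exists j; first exact: ltnW.
by rewrite ifN //; apply: contraTneq ltj => ->; rewrite ltnn.
Qed.

(** * Excluding a symmetric decomposition with 6 k + 1 terms *)

Lemma comon_tensor_no_symdec (R : realFieldType) k (l : 'I_k -> point -> R)
    (lam : 'I_(k * 6).+1 -> R) v :
  independent_powers l ->
  vanishing_on_blocks l ->
  ~ symdec l lam v.
Proof.
move=> free pure dec.
have [L [M [cM killed]]] := symdec_kill free dec (leqnn 5).
(* Five modes remove 5 k terms; the last mode stays available for reading off new and old
   coordinates. *)
have {}cM : #|M| = k.+1 by lia.
have [e sumM] := sum_set_ord cM.
pose lm a := lam (e a); pose w a := v (e a).
pose p a (j : 'I_5) x := pairing (shear (L (lift ord_max j)) x) (w a).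
pose A a (x : 'I_5 -> point) := \prod_j p a j (x j).
have restrict (g : 'I_(k * 6).+1 -> R) (x : 'I_5 -> point) :
    \sum_m g m * \prod_j pairing (shear (L (lift ord_max j)) (x j)) (v m) =
    \sum_a g (e a) * A a x.
  rewrite -(sumM _ (fun m => g m * \prod_j pairing (shear (L (lift ord_max j)) (x j)) (v m))).
  rewrite [RHS]big_mkcond; apply: eq_bigr => m _; case: ifPn => // /killed [j lt5 kj].
  case: (unliftP ord_max j) => [a ja|jE]; last by rewrite jE ltnn in lt5.
  by rewrite (bigD1 a) //= -ja kj mul0r mulr0.
(* By [combG], combinations of the [A a] with coefficients in the row space of [G] lie in W. By the
   choice of [mu] below, these are the coefficient rows [r] with [r *m mu = 0]. *)
pose G : 'M[R]_(k, k.+1) := \matrix_(q, a) (lm a * w a (inr q)).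
have combG (c : 'rV[R]_k) x :
    \sum_a (c *m G) 0 a * A a x = \sum_q c 0 q * \prod_j l q (x j).
  rewrite -(symdec_contract_new L (c 0) ord_max x dec) restrict.
  apply: eq_bigr => a _; rewrite mxE mulr_sumr; congr (_ * _).
  by apply: eq_bigr => q _; rewrite mxE mulrCA.
have freeG : row_free G.
  apply: row_free_of_inj => c cG; apply/rowP => q; rewrite [RHS]mxE.
  apply: (free (c 0)) => x; rewrite -combG cG big1 // => a _.
  by rewrite mxE mul0r.
have [mu [mu0 Gmu kerG]] := row_free_kernel_vector freeG.
have pair_comb a a' : exists r : 'rV[R]_k.+1, exists2 c : 'rV[R]_k,
    r = c *m G &
    r = mu a' 0 *: delta_mx 0 a - mu a 0 *: delta_mx 0 a'.
  pose r : 'rV[R]_k.+1 := mu a' 0 *: delta_mx 0 a - mu a 0 *: delta_mx 0 a'.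
  have /kerG [c cG] : r *m mu = 0.
    rewrite mulmxBl -!scalemxAl -!rowE; apply/matrixP => i j.
    by rewrite !ord1 !mxE mulrC subrr.
  by exists r, c.
have combA a a' x :
    \sum_b (mu a' 0 *: delta_mx 0 a - mu a 0 *: delta_mx 0 a' : 'rV[R]_k.+1) 0 b * A b x =
    mu a' 0 * A a x - mu a 0 * A a' x.
  have deltaA b : \sum_a (delta_mx 0 b : 'rV[R]_k.+1) 0 a * A a x = A b x.
    rewrite (bigD1 b) //= mxE !eqxx mul1r big1 ?addr0 // => b' /negPf bb'.
    by rewrite mxE bb' andbF mul0r.
  rewrite -!deltaA !mulr_sumr -sumrB; apply: eq_bigr => b _.
  by rewrite !mulrA -mulrBl; congr (_ * _); rewrite !mxE.
have pure_comb a a' (x : 'I_5 -> point) b : injective x -> (forall j, (x j).1 = b) ->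
    mu a' 0 * A a x = mu a 0 * A a' x.
  move=> inj_x xb; have [r [c rG rE]] := pair_comb a a'.
  apply/eqP; rewrite -subr_eq0 -combA -rE rG combG big1 // => q _.
  by rewrite (pure _ _ b) ?mulr0.
(* At distinct places of one block [pure_comb] makes the [A a'] proportional to the [mu a'], so the
   contraction in the last mode collapses to one product of [A a] with the vector [z]. *)
pose z u := \sum_a lm a * mu a 0 * w a (inl u).
have Az a (x : 'I_6 -> point) b : injective x -> (forall j, (x j).1 = b) ->
    A a (fun j => x (lift ord_max j)) * z (x ord_max) = (if b then 6 else -6) * mu a 0.
  move=> inj_x xb; rewrite -(symdec_contract_old L pure dec inj_x xb) restrict.
  rewrite mulr_sumr mulr_suml; apply: eq_bigr => a' _.
  have := @pure_comb a' a (fun j => x (lift ord_max j)) b.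
  rewrite -[_ * A a' _ * _]mulrA [A a' _ * _]mulrC => -> //.
    by rewrite /lm /w; ring.
  by move=> j j' /inj_x /lift_inj.
have signN0 (b : bool) a : mu a 0 != 0 -> (if b then 6 else -6) * mu a 0 != 0.
  by move=> ma; rewrite mulf_neq0 //; case: b; rewrite ?oppr_eq0 pnatr_eq0.
pose p6 a (j : 'I_6) u := if unlift ord_max j is Some i then p a i u else z u.
have p6l a i u : p6 a (lift ord_max i) u = p a i u by rewrite /p6 liftK.
have p6m a u : p6 a ord_max u = z u by rewrite /p6 unlift_none.
have prod6 a b (i : 'I_6 -> 'I_7) : injective i ->
    \prod_j p6 a j (b, i j) = (if b then 6 else -6) * mu a 0.
  move=> inj_i; rewrite -(Az a (fun j => (b, i j))) //; last by move=> j j' [/inj_i].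
  rewrite (bigD1 ord_max) //= p6m mulrC prod_lift.
  by congr (_ * _); apply: eq_bigr => j _; rewrite p6l.
have p6_const a j b u u' : mu a 0 != 0 -> p6 a j (b, u) = p6 a j (b, u').
  move=> ma; apply: (constant_of_injective_products (signN0 b a ma)
            (p := fun j u => p6 a j (b, u))); exact: prod6.
have p_const a j x : mu a 0 != 0 -> p a j x = p a j (x.1, ord0).
  by case: x => b u ma; rewrite -!p6l; apply: p6_const.
have inj_wid : injective (widen_ord (leqnSn 6)).
  by move=> i i' /(congr1 val) /= /val_inj.
have p6N0 a j b u : mu a 0 != 0 -> p6 a j (b, u) != 0.
  move=> ma; have := signN0 b a ma; rewrite -(prod6 _ _ _ inj_wid).
  rewrite prodf_seq_neq0 => /allP /(_ j (mem_index_enum _)) /=.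
  by rewrite (p6_const _ _ _ _ u).
have [a0 ma0] : exists a0, mu a0 0 != 0.
  by case/cV0Pn: mu0 => a0; exists a0.
(* Two nonzero entries of [mu] would give an element of W that depends only on blocks and vanishes
   on each block. [sym_binary_rank_two] makes it 0, freeness makes its coefficients [c] 0, and then
   [r = 0] contradicts [mu a0 0 != 0]. *)
have mu_single a : a != a0 -> mu a 0 = 0.
  move=> aa0; apply/eqP; apply: contraTT isT => ma.
  have [r [c rG rE]] := pair_comb a a0.
  have comb0 x : mu a0 0 * A a x - mu a 0 * A a0 x = 0.
    pose B j := (x j).1.
    have AE a' y : mu a' 0 != 0 -> A a' y = \prod_j p a' j ((y j).1, ord0).
      by move=> ma'; apply: eq_bigr => j _; apply: p_const.
    rewrite !AE //.
    have pairE y : mu a0 0 * \prod_j p a j ((y j).1, ord0) -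
        mu a 0 * \prod_j p a0 j ((y j).1, ord0) = \sum_q c 0 q * \prod_j l q (y j).
      by rewrite -!AE // -combA -rE rG combG.
    have pure0 b : mu a0 0 * \prod_j p a j (b, ord0) -
        mu a 0 * \prod_j p a0 j (b, ord0) = 0.
      pose y (j : 'I_5) : point := (b, widen_ord (leqnSn 6) (widen_ord (leqnSn 5) j)).
      apply/eqP; rewrite subr_eq0; apply/eqP.
      have := @pure_comb a a0 y b; rewrite !AE //; apply=> //.
      by move=> j j' [] /val_inj.
    have := @sym_binary_rank_two R 5 (fun j b => p a j (b, ord0))
      (fun j b => p a0 j (b, ord0)) (mu a0 0) (mu a 0) isT isT ma0.
    apply=> //.
    - by move=> j b; rewrite -p6l p6N0.
    - by move=> j b; rewrite -p6l p6N0.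
    - move=> s B'.
      have h1 := pairE (fun j => (B' (s j), ord0)).
      have h2 := pairE (fun j => (B' j, ord0)).
      rewrite [LHS]h1 [RHS]h2; apply: eq_bigr => q _; congr (_ * _).
      by rewrite [RHS](reindex_inj (@perm_inj _ s)).
  have c0 q : c 0 q = 0.
    apply: (free (c 0)) => x; rewrite -combG -rG rE combA; exact: comb0.
  have : r 0 a = 0.
    by rewrite rG mxE big1 // => q _; rewrite c0 mul0r.
  rewrite rE !mxE !eqxx (negPf aa0) /= mulr1 mulr0 subr0 => /eqP.
  by rewrite (negPf ma0).
have zE u : z u = lm a0 * mu a0 0 * w a0 (inl u).
  rewrite /z (bigD1 a0) //= big1 ?addr0 // => a /mu_single ->.
  by rewrite mulr0 mul0r.
have lm0 : lm a0 != 0.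
  have := p6N0 a0 ord_max true ord0 ma0; rewrite p6m zE.
  by apply: contra => /eqP ->; rewrite !mul0r.
(* With [mu] supported at [a0], the equation [G *m mu = 0] says that the new coordinates of [w a0]
   vanish. *)
have w_old q : w a0 (inr q) = 0.
  have := congr1 (fun C : 'cV_ _ => C q 0) Gmu; rewrite mxE [RHS]mxE.
  rewrite (bigD1 a0) //= big1 ?addr0 => [|a /mu_single ->]; last by rewrite mulr0.
  rewrite mxE => /eqP; rewrite !mulf_eq0 (negPf lm0) (negPf ma0) orbF.
  by move/eqP.
have pE j x : p a0 j x = w a0 (inl x).
  by rewrite /p pairing_shear big1 ?subr0 // => q _; rewrite w_old mulr0.
(* All shears now act trivially on [w a0], so the six constant factors are five copies of its value
   on the block and the multiple [z] of that value. *)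
have power b : lm a0 * w a0 (inl (b, ord0)) ^+ 6 = if b then 6 else -6.
  apply: (mulIf ma0); rewrite -(prod6 _ _ _ inj_wid).
  rewrite (eq_bigr (fun j => p6 a0 j (b, ord0))) => [|j _]; last exact: p6_const.
  rewrite (bigD1 ord_max) //= p6m zE prod_lift.
  rewrite (eq_bigr (fun=> w a0 (inl (b, ord0)))) => [|j _]; last by rewrite p6l pE.
  by rewrite prodr_const card_ord; ring.
have := power true; have := power false.
have := exprn_even_ge0 (w a0 (inl (true, ord0))) (isT : ~~ odd 6).
have := exprn_even_ge0 (w a0 (inl (false, ord0))) (isT : ~~ odd 6).
move: (_ ^+ 6) (_ ^+ 6) => s t s0 t0 h1 h2.
have [lam0|/ltW lam0] := lerP 0 (lm a0).
  by have := mulr_ge0 lam0 s0; rewrite h1 oppr_ge0 lern0.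
by have := mulr_le0_ge0 lam0 t0; rewrite h2 lern0.
Qed.

(** * Rank bookkeeping and the conclusion *)

Lemma rank_le_fintype (R : realType) n d (T : tensor R n d) (J : finType)
    (v : J -> 'I_d -> 'I_n -> R) :
  (forall i : {ffun 'I_d -> 'I_n}, T i = \sum_t \prod_j v t j (i j)) -> rank_le T #|J|.
Proof.
move=> hT; exists (fun a => v (enum_val a)) => i.
by rewrite hT -(big_enum_val (A := predT) (fun t => \prod_j v t j (i j))).
Qed.

Lemma symrank_le_fintype (R : realType) n d (T : tensor R n d) (J : finType)
    (lam : J -> R) (v : J -> 'I_n -> R) :
  (forall i : {ffun 'I_d -> 'I_n}, T i = \sum_t lam t * \prod_j v t (i j)) ->
  symrank_le T #|J|.
Proof.
move=> hT; exists (fun a => lam (enum_val a)), (fun a => v (enum_val a)) => i.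
by rewrite hT -(big_enum_val (A := predT) (fun t => lam t * \prod_j v t (i j))).
Qed.

Lemma symrank_le_finite (R : realType) n d (T : tensor R n d) :
  sym_tensor T -> exists r, symrank_le T r.
Proof.
move=> /polarization symT; eexists.
apply: (@symrank_le_fintype _ _ _ _ ({ffun 'I_d -> 'I_n} * {set 'I_d})%type
  (fun t => T t.1 / (d`!)%:R * (-1) ^+ #|~: t.2|)
  (fun t x => \sum_(p in t.2) (x == t.1 p)%:R)) => i.
by rewrite symT pair_big.
Qed.

Lemma symrank_le_widen (R : realType) n d (T : tensor R n d) r r' :
  (r <= r')%N -> symrank_le T r -> symrank_le T r'.
Proof.
move=> /subnKC <- [lam [v hT]].
exists (fun k => if split k is inl a then lam a else 0),
  (fun k => if split k is inl a then v a else fun=> 0) => i.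
rewrite hT big_split_ord /= [X in _ + X]big1 ?addr0 => [|a _]; last first.
  by rewrite (unsplitK (inr _ a)) mul0r.
by apply: eq_bigr => a _; rewrite (unsplitK (inl _ a)).
Qed.

Lemma least_nat (P : nat -> Prop) m : P m ->
  exists r, P r /\ forall r', P r' -> (r <= r')%N.
Proof.
move=> Pm; have ex : exists m, `[< P m >] by exists m; apply/asboolP.
case: (ex_minnP ex) => r /asboolP Pr rmin; exists r; split=> // r' Pr'.
by apply: rmin; apply/asboolP.
Qed.

Theorem theorem1p2 (R : realType) :
  exists (n : nat) (T : tensor R n 6),
    sym_tensor T /\
    exists r s : nat, is_rank T r /\ is_symrank T s /\ r <> s.
Proof.
have [k [l [free pure span]]] := mixed_power_basis R.
(* The basis is enumerated because [tensor] takes its indices in an ordinal. *)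
pose K : finType := (point + 'I_k)%type.
pose T : tensor R #|K| 6 := fun i => comon_tensor l (fun j => enum_val (i j) : K).
have symT : sym_tensor T.
  move=> s i; rewrite /T -[RHS](comon_tensor_perm _ _ s); congr comon_tensor.
  by apply/funext => j; rewrite ffunE.
exists #|K|, T; split=> //.
have rankT : rank_le T (k * 6).+1.
  have [v hv] := comon_tensor_rank span.
  have := @rank_le_fintype _ _ _ T _ (fun t j x => v t j (enum_val x)).
  by rewrite card_option card_prod !card_ord; apply=> i; apply: hv.
have [r [rT rmin]] := least_nat rankT.
have [s0 /least_nat [s [sT smin]]] := symrank_le_finite symT.
exists r, s; split=> //; split=> // rs.
(* If the ranks were equal, the symmetric rank would be at most 6 k + 1, and padding with zero terms
   would give exactly that length. *)
have [lam [v hT]] : symrank_le T (k * 6).+1.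
  by apply: symrank_le_widen sT; rewrite -rs; apply: rmin.
apply: (@comon_tensor_no_symdec _ _ l lam (fun m x => v m (enum_rank x))) => // i.
have := hT [ffun j => enum_rank (i j)]; rewrite /T.
rewrite [X in comon_tensor l X](_ : _ = i) => [->|]; last first.
  by apply/funext => j; rewrite ffunE enum_rankK.
by apply: eq_bigr => m _; congr (_ * _); apply: eq_bigr => j _; rewrite ffunE.
Qed.
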